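(* Assume a convex equation of state $\varepsilon=\varepsilon(\tau,S)$, well prepared initial data in the sense that $\tau_c(0)>0$ and $S_c(0)\ge0$ for every cell $c$, and positive cell volumes $|\omega_c(t)|>0$ for all times $t\ge0$. Then the adaptive semi-discrete scheme $$m_c\frac{\mathrm d\mathbf u_c}{\mathrm dt}=\sum_{p\in\mathcal P(c)}\Big[(1-\beta_p)\,\mathbf F^{C}_{pc}+\beta_p\,\mathbf F^{S}_{pc}\Big],\qquad \mathbf u_c=(\tau_c,\mathbf v_c,S_c)^\top,$$ which blends the entropy conservative fluctuations $\mathbf F^C_{pc}$ and the entropy stable fluctuations $\mathbf F^S_{pc}$, is positivity preserving for density, pressure and temperature, that is, for all cells $c$ and all times $t\ge0$, $$\rho_c(t)>0,\qquad p_c(t)\ge0,\qquad\theta_c(t)\ge0.$$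
   Context: Mesh: a bounded moving domain $\Omega(t)\subset\mathbb R^2$ is covered by a conforming mesh of finitely many non-overlapping triangles $\omega_c(t)$ (cells) of volume (area) $|\omega_c(t)|$, with vertices (nodes) at positions $\mathbf x_p(t)$; the mesh topology is fixed in time. $\mathcal P(c)$ is the set of vertices of cell $c$, and $\mathcal C(p)$ the set of cells sharing node $p$. For $p\in\mathcal P(c)$, the two edges of $\omega_c$ meeting at $p$ have half-lengths $l_{pc}^\pm$ and unit normals $\mathbf n_{pc}^\pm$ pointing outward from $\omega_c$; the corner vector is $l_{pc}\mathbf n_{pc}=l_{pc}^+\mathbf n_{pc}^++l_{pc}^-\mathbf n_{pc}^-$, with Euclidean norm $\|l_{pc}\mathbf n_{pc}\|$. Unknowns and equation of state: $\tau_c$ (specific volume), $\mathbf v_c\in\mathbb R^2$ (velocity), $S_c$ (specific entropy) are functions of time for each cell; $\rho_c=1/\tau_c$ is the density; $m_c=|\omega_c(t)|/\tau_c(t)$ is the cell mass, constant in time. The specific internal energy $\varepsilon(\tau,S)$ is a given smooth convex function with $\partial^2\varepsilon/\partial\tau^2>0$; $p=-\partial\varepsilon/\partial\tau$ is the pressure, $\theta=\partial\varepsilon/\partial S$ the temperature, which is assumed strictly positive, and $a>0$ with $a^2/\tau^2=\partial^2\varepsilon/\partial\tau^2$ the sound speed. A subscript $c$ denotes evaluation at $(\tau_c,S_c)$. Entropy conservative fluctuations: $$\mathbf F^C_{pc}=\Big(l_{pc}\mathbf n_{pc}\cdot(\mathbf v_p-\mathbf v_c),\;-l_{pc}\mathbf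 n_{pc}(p_p-p_c)-\|l_{pc}\mathbf n_{pc}\|\alpha_p(\mathbf v_c-\mathbf v_p),\;0\Big)^\top,$$ where $\mathbf v_p=\frac{\sum_{c\in\mathcal C(p)}\|l_{pc}\mathbf n_{pc}\|\mathbf v_c}{\sum_{c\in\mathcal C(p)}\|l_{pc}\mathbf n_{pc}\|}$, $p_p=\frac{\sum_{c\in\mathcal C(p)}\|l_{pc}\mathbf n_{pc}\|p_c}{\sum_{c\in\mathcal C(p)}\|l_{pc}\mathbf n_{pc}\|}$ and $\alpha_p=\frac{\sum_{c\in\mathcal C(p)}l_{pc}\mathbf n_{pc}\cdot(p_c\mathbf v_c-p_c\mathbf v_p-p_p\mathbf v_c)}{\sum_{c\in\mathcal C(p)}\|l_{pc}\mathbf n_{pc}\||\mathbf v_c-\mathbf v_p|^2}$ (with $\alpha_p=0$ if the denominator vanishes). Entropy stable fluctuations: $$\mathbf F^S_{pc}=\Big(l_{pc}\mathbf n_{pc}\cdot(\mathbf v_p^*-\mathbf v_c),\;\mathbf M_{pc}(\mathbf v_p^*-\mathbf v_c),\;\Pi_{pc}\Big)^\top,\qquad \Pi_{pc}=\frac1{\theta_c}(\mathbf v_c-\mathbf v_p^* )\cdot\mathbf M_{pc}(\mathbf v_c-\mathbf v_p^* ),$$ where $\mathbf M_{pc}=\frac{a_c}{\tau_c}\big(l_{pc}^-\mathbf n_{pc}^-\otimes\mathbf n_{pc}^-+l_{pc}^+\mathbf n_{pc}^+\otimes\mathbf n_{pc}^+\big)$ and $\mathbf v_p^*$ solves $\big(\sum_{c\in\mathcal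 C(p)}\mathbf M_{pc}\big)\mathbf v_p^*=\sum_{c\in\mathcal C(p)}\big(l_{pc}\mathbf n_{pc}p_c+\mathbf M_{pc}\mathbf v_c\big)$. At boundary nodes, the nodal quantities $\mathbf v_p,p_p,\alpha_p,\mathbf v_p^*$ may instead be given by boundary conditions. The blending factor $\beta_p\in\{0,1\}$ is attached to each node and may vary in time ($1$ for discontinuous flow, $0$ for smooth flow). Nodes move with $\mathrm d\mathbf x_p/\mathrm dt=(1-\beta_p)\mathbf v_p+\beta_p\mathbf v_p^*$.
   Formalization: The formal theorem also assumes nonnegative pressure at zero entropy, p(τ,0) ≥ 0 for all τ > 0; without it the claim p_c ≥ 0 fails, e.g. for ε = τ²/2 + e^S with a static uniform state, where p = −τ < 0. *)

(* Defs.v *)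
From HB Require Import structures.
From mathcomp Require Import all_boot all_order all_algebra.
From mathcomp Require Import all_classical all_reals all_analysis.

Set Implicit Arguments.
Unset Strict Implicit.
Unset Printing Implicit Defensive.

Import Order.TTheory GRing.Theory Num.Theory.
Import numFieldNormedType.Exports.
Local Open Scope classical_set_scope.
Local Open Scope ring_scope.

(* The library norm on 'cV[R]_2 is the sup norm (same topology); lengths use
   the Euclidean norm [enorm]. *)
Definition dot (R : realType) (u v : 'cV[R]_2) : R := \sum_i u i 0 * v i 0.

Definition enorm (R : realType) (u : 'cV[R]_2) : R := Num.sqrt (dot u u).

(* Rotation by a quarter turn; dot (quarter_turn u) v is the planar cross product. *)
Definition quarter_turn (R : realType) (u : 'cV[R]_2) : 'cV[R]_2 :=
  \col_i (if i == 0 then - u 1 0 else u 0 0).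

(* Fixed topology of a finite triangular mesh. *)
Record mesh := Mesh {
  node : finType;
  cell : finType;
  vertex : cell -> 'I_3 -> node;
  vertex_inj : forall c, injective (vertex c);
  vertex_surj : forall p, exists c i, vertex c i = p
}.

Section Geometry.
Variables (R : realType) (K : mesh).
Implicit Types (c : cell K) (p q : node K) (x : node K -> 'cV[R]_2).

Definition cell_nodes c : {set node K} := [set vertex c i | i : 'I_3].

Definition node_cells p : {set cell K} := [set c | p \in cell_nodes c].

(* An edge of a conforming triangulation lies on the boundary of the domain
   iff it belongs to exactly one cell; boundary nodes are the endpoints of
   such edges. *)
Definition boundary_node p : bool :=
  [exists q, (q != p) &&
     (#|[set c | (p \in cell_nodes c) && (q \in cell_nodes c)]| == 1)%N].

Definition volume x c : R :=
  `|dot (quarter_turn (x (vertex c 1) - x (vertex c 0)))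
        (x (vertex c 2) - x (vertex c 0))| / 2.

Definition centroid x c : 'cV[R]_2 := 3^-1 *: \sum_(p in cell_nodes c) x p.

(* Unit normal of the edge [x_p, x_q] of the cell c; the sign makes it point
   away from the centroid, hence outward. *)
Definition edge_normal x c p q : 'cV[R]_2 :=
  let e := quarter_turn (x q - x p) in
  (Num.sg (dot e (x p - centroid x c)) / enorm e) *: e.

Definition half_length x p q : R := enorm (x q - x p) / 2.

(* The two edges of c meeting at p join p to the two other vertices of c;
   sums over q \in cell_nodes c :\ p replace the labels + and -. *)
Definition corner x c p : 'cV[R]_2 :=
  \sum_(q in cell_nodes c :\ p) half_length x p q *: edge_normal x c p q.

Definition hull x (A : {set node K}) : set 'cV[R]_2 :=
  [set y | exists w : node K -> R,
     [/\ forall p, 0 <= w p, \sum_(p in A) w p = 1 &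
         y = \sum_(p in A) w p *: x p]].

Definition conforming x : Prop :=
  forall c c', c != c' ->
    interior (hull x (cell_nodes c)) `&` interior (hull x (cell_nodes c')) = set0 /\
    hull x (cell_nodes c) `&` hull x (cell_nodes c') =
      hull x (cell_nodes c :&: cell_nodes c').

End Geometry.

Section EquationOfState.
Variable R : realType.
Implicit Types (eps : R -> R -> R) (U : set (R * R)).

Definition dtau (f : R -> R -> R) : R -> R -> R := fun tau S => derive1 (f^~ S) tau.
Definition dS (f : R -> R -> R) : R -> R -> R := fun tau S => derive1 (f tau) S.

Fixpoint Ck U (k : nat) (f : R -> R -> R) : Prop :=
  (forall y, U y -> {for y, continuous (fun z : R * R => f z.1 z.2)}) /\
  if k is k'.+1 then
    [/\ forall y, U y -> derivable (f^~ y.2) y.1 1 /\ derivable (f y.1) y.2 1,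
        Ck U k' (dtau f) & Ck U k' (dS f)]
  else True.

Definition thermo_domain : set (R * R) := [set y | 0 < y.1 /\ 0 <= y.2].

Definition pressure eps tau S : R := - dtau eps tau S.
Definition temperature eps tau S : R := dS eps tau S.
Definition sound_speed eps tau S : R := tau * Num.sqrt (dtau (dtau eps) tau S).

(* Convexity is joint in (tau, S); smoothness up to the edge S = 0 is
   smoothness on an open neighbourhood. *)
Definition equation_of_state eps : Prop :=
  [/\ exists U, [/\ open U, thermo_domain `<=` U & forall k, Ck U k eps],
      convex_function thermo_domain (fun y : R * R => eps y.1 y.2),
      forall tau S, thermo_domain (tau, S) -> 0 < dtau (dtau eps) tau S &
      forall tau S, thermo_domain (tau, S) -> 0 < temperature eps tau S].

End EquationOfState.

Section Fluctuations.
Variables (R : realType) (K : mesh).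
Implicit Types (c : cell K) (p : node K) (x : node K -> 'cV[R]_2).
Implicit Types (pr : cell K -> R) (v : cell K -> 'cV[R]_2).
Implicit Types (vp vc : 'cV[R]_2) (pp alphap pc tauc Sc : R).

Definition nodal_velocity x v p : 'cV[R]_2 :=
  (\sum_(c in node_cells p) enorm (corner x c p))^-1 *:
  \sum_(c in node_cells p) enorm (corner x c p) *: v c.

Definition nodal_pressure x pr p : R :=
  (\sum_(c in node_cells p) enorm (corner x c p) * pr c) /
  \sum_(c in node_cells p) enorm (corner x c p).

(* Division by 0 returns 0, as required when the denominator vanishes. *)
Definition nodal_alpha x v pr vp pp p : R :=
  (\sum_(c in node_cells p)
     dot (corner x c p) (pr c *: v c - pr c *: vp - pp *: v c)) /
  \sum_(c in node_cells p)
     enorm (corner x c p) * dot (v c - vp) (v c - vp).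

Definition corner_matrix (eps : R -> R -> R) x c p tauc Sc : 'M[R]_2 :=
  (sound_speed eps tauc Sc / tauc) *:
  \sum_(q in cell_nodes c :\ p)
    half_length x p q *: (edge_normal x c p q *m (edge_normal x c p q)^T).

Definition flux_conservative x c p vp pp alphap vc pc : R * 'cV[R]_2 * R :=
  (dot (corner x c p) (vp - vc),
   - ((pp - pc) *: corner x c p)
     - (enorm (corner x c p) * alphap) *: (vc - vp),
   0).

Definition flux_stable eps x c p vp tauc vc Sc : R * 'cV[R]_2 * R :=
  let M := corner_matrix eps x c p tauc Sc in
  (dot (corner x c p) (vp - vc),
   M *m (vp - vc),
   (temperature eps tauc Sc)^-1 * dot (vc - vp) (M *m (vc - vp))).

End Fluctuations.

(* Main.v *)
Require Import Defs.
From HB Require Import structures.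
From mathcomp Require Import all_boot all_order all_algebra.
From mathcomp Require Import all_classical all_reals all_analysis.
From mathcomp Require Import ring lra.
Import Order.TTheory GRing.Theory Num.Theory.
Import numFieldNormedType.Exports.
Local Open Scope classical_set_scope.
Local Open Scope ring_scope.

(** The specific volume is controlled by geometry, the entropy by dissipation,
and the pressure and temperature by the equation of state.

- Density. The corner vectors of a triangle are the gradient of its area with
respect to the positions of its vertices, and they sum to zero
([sum_corner_dot], [sum_corner_eq0]). The volume equation of the scheme blends
the nodal velocities exactly as the mesh motion does, so [m c * tau c] and the
volume of the cell have the same derivative and remain equal
([mass_eq_volume]); as the volume is positive, so is [tau c].

- Entropy. Conservative nodes do not change the entropy, and stable nodes
produce a nonnegative quadratic form divided by the temperature
([corner_matrix_form_ge0]). The sign of the temperature is known only for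
nonnegative entropy, which is what has to be proved. It is however positive in
a neighbourhood of any admissible state ([temperature_gt0_near]), so that the
entropy cannot start decreasing at a time when it vanishes, and stays
nonnegative by the barrier argument of [barrier_ge0].

- Temperature and pressure. Every state is thus in the thermodynamic domain,
where the temperature is positive by assumption. For the pressure, the energy
is nonincreasing in the volume along [S = 0], hence bounded above for large
volumes there, and joint convexity propagates the bound to every isentrope; a
convex function of the volume bounded above for large volumes is nonincreasing
([pressure_ge0]).

The equations hold outside a countable set of times, so the passage from signs
of derivatives to monotonicity rests on [derive_ge0_le] instead of the mean
value theorem. *)

(** * Monotonicity off a countable set *)

Lemma derive_gt0_right (R : realType) (f : R -> R) (s : R) :
  derivable f s 1 -> 0 < 'D_1 f s ->
  exists2 d, 0 < d & forall t, s < t < s + d -> f s < f t.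
Proof.
move=> dfs Df.
have := cvgr_gt _ dfs _ Df.
move=> [e /= e0 fe]; exists e => // t /andP[st te].
have := fe (t - s) => /=.
rewrite sub0r normrN gtr0_norm ?subr_gt0// ltrBlDl te => /(_ isT).
rewrite subr_eq0 gt_eqF// => /(_ isT).
by rewrite /GRing.scale/= mulr1 subrK pmulr_rgt0 ?invr_gt0 ?subr_gt0.
Qed.

(** The set where [f] takes the value [y] on [[a, b]] is compact and, by the
    intermediate value theorem, nonempty; the crossing is its largest point. *)
Lemma last_crossing (R : realType) (f : R -> R) (a b y : R) :
  a <= b -> {within `[a, b], continuous f} -> y <= f a -> f b < y ->
  exists s, [/\ a <= s, s < b, f s = y & forall t, s < t <= b -> f t < y].
Proof.
move=> ab cf yfa fby.
pose A : set R := f @^-1` [set y] `&` `[a, b].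
have A0 : A !=set0.
  have [|c cab fc] := IVT (v := y) ab cf; last by exists c.
  by rewrite ge_min le_max yfa (ltW fby) orbT.
have cA : compact A.
  have : closed (f @^-1` [set y] : set (subspace `[a, b])).
    by move/continuous_closedP : cf; apply; exact: closed_eq.
  move=> /closed_subspaceP[V cV VE].
  rewrite /A -VE setIC; apply: compact_closedI => //.
  exact: segment_compact.
have [s /set_mem[/= fs sab] smax] : exists2 s, s \in A & forall t, t \in A -> t <= s.
  apply: (@compact_EVT_max _ R id A) => //.
  by apply: continuous_subspaceT => x; exact: cvg_id.
move: sab; rewrite in_itv/= => /andP[as_ sb].
have lts : s < b by rewrite lt_neqAle sb andbT; apply: contraTneq fby => <-; rewrite fs ltxx.
exists s; split => // t /andP[st tb].
rewrite ltNge; apply/negP => yft.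
have ta : a <= t by exact: le_trans as_ (ltW st).
have [||c] := @IVT _ f t b y tb.
- apply: continuous_subspaceW cf => z /=.
  by rewrite !in_itv/= => /andP[tz ->]; rewrite (le_trans ta).
- by rewrite ge_min le_max yft (ltW fby) orbT.
rewrite in_itv/= => /andP[tc cb] fc.
have /smax : c \in A.
  by apply/mem_set; split => //=; rewrite in_itv/= cb (le_trans ta).
by move=> cs; move: (lt_le_trans st (le_trans tc cs)); rewrite ltxx.
Qed.

(** A countable set is Lebesgue null, an open interval is not. *)
Lemma exists_notin_countable (R : realType) (B : set R) (c d : R) :
  countable B -> c < d -> exists2 y, c < y < d & ~ B y.
Proof.
move=> cB cd; apply: contrapT => H.
have sub : `]c, d[ `<=` B.
  move=> y /=; rewrite in_itv/= => cyd.
  by apply: contrapT => By; apply: H; exists y.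
have : lebesgue_measure (`]c, d[ : set R) = 0.
  apply: countable_lebesgue_measure0.
  exact: sub_countable (subset_card_le sub) cB.
rewrite lebesgue_measure_itv/= lte_fin cd -EFinB => -[] /eqP.
by rewrite subr_eq0 (gt_eqF cd).
Qed.

(** Zygmund's argument. If [f b < f a], some level [y] strictly between them
    is not the image of an exceptional time. At the last time [f] equals [y]
    the derivative therefore exists and is positive, so [f] exceeds [y] just
    afterwards, although it must stay below [y] from then on. *)
Lemma derive_gt0_le (R : realType) (f : R -> R) (T : set R) (a b : R) :
  countable T -> a <= b -> {within `[a, b], continuous f} ->
  (forall t, a < t < b -> ~ T t -> derivable f t 1 /\ 0 < 'D_1 f t) ->
  f a <= f b.
Proof.
move=> cT ab cf df; rewrite leNgt; apply/negP => fba.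
have cfT : countable (f @` T) by exact: sub_countable (card_image_le _ _) cT.
have [y /andP[fby yfa] yT] := exists_notin_countable _ _ _ _ cfT fba.
have [s [as_ sb fs slast]] := last_crossing _ _ _ _ _ ab cf (ltW yfa) fby.
have lt_as : a < s.
  by rewrite lt_neqAle as_ andbT; apply: contraTneq yfa => ->; rewrite fs ltxx.
have [||dfs Df] := df s; [by rewrite lt_as| by move=> Ts; apply: yT; exists s|].
have [d d0 fd] := derive_gt0_right _ _ _ dfs Df.
(* a time after s, before b and within the range of the local information *)
pose t := s + Num.min (d / 2) (b - s).
have m0 : 0 < Num.min (d / 2) (b - s) by rewrite lt_min divr_gt0//= subr_gt0.
have st : s < t by rewrite ltrDl.
have tb : t <= b by rewrite /t -lerBrDl ge_min lexx orbT.
have td : t < s + d by rewrite ltrD2l gt_min; apply/orP; left; lra.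
have := fd t; rewrite st td => /(_ isT).
have := slast t; rewrite st tb => /(_ isT).
by rewrite fs => /lt_trans/[apply]; rewrite ltxx.
Qed.

(** The exceptional set forbids the mean value theorem; adding the small
    slope [e] reduces to a strictly positive derivative. *)
Lemma derive_ge0_le (R : realType) (f : R -> R) (T : set R) (a b : R) :
  countable T -> a <= b -> {within `[a, b], continuous f} ->
  (forall t, a < t < b -> ~ T t -> derivable f t 1 /\ 0 <= 'D_1 f t) ->
  f a <= f b.
Proof.
move=> cT ab cf df.
suff H e : 0 < e -> f a + e * a <= f b + e * b.
  rewrite leNgt; apply/negP => fba.
  (* + 1 keeps the denominator positive when a = b *)
  have e0 : 0 < (f a - f b) / (2 * (b - a + 1)).
    by rewrite divr_gt0 ?subr_gt0// mulr_gt0//; lra.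
  have := H _ e0; set e := _ / _ => He.
  have eE : e * (b - a + 1) = (f a - f b) / 2.
    by rewrite /e; field; lra.
  nra.
move=> e0.
pose g : R -> R := f + e \*: id.
suff : g a <= g b by [].
apply: (derive_gt0_le _ _ T) => //.
  apply: within_continuousD => //.
  apply: continuous_subspaceT => x; exact: scaler_continuous.
move=> t tab Tt.
have [dft Dft] := df t tab Tt.
have dg : is_derive t 1 g ('D_1 f t + e).
  apply: is_deriveD; first exact: derivableP.
  by apply: is_derive_eq; rewrite /GRing.scale/= mulr1.
split; first exact: ex_derive.
by rewrite derive_val; exact: ltr_wpDl.
Qed.

Lemma derive_eq0_eq (R : realType) (f : R -> R) (T : set R) (a b : R) :
  countable T -> a <= b -> {within `[a, b], continuous f} ->
  (forall t, a < t < b -> ~ T t -> is_derive t 1 f 0) ->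
  f a = f b.
Proof.
move=> cT ab cf df; apply/eqP; rewrite eq_le; apply/andP; split.
  apply: (derive_ge0_le _ _ T) => // t tab Tt; have dft := df t tab Tt.
  by split; [exact: ex_derive|rewrite derive_val].
rewrite -lerN2; apply: (derive_ge0_le _ (- f) T) => //.
  by move=> t; apply: continuousN; exact: cf.
move=> t tab Tt; have dft := df t tab Tt.
have dNft : is_derive t 1 (- f) 0 by apply: is_derive_eq; rewrite oppr0.
by split; [exact: ex_derive|rewrite derive_val].
Qed.

(** If [f] were negative at [b], it would be negative just after the last time
    it vanishes before [b]; but near that time the sign of the derivative makes
    it nondecreasing. The sign is asked for only just after times where [f] is
    nonnegative, which suits an unknown whose equation controls the derivative
    only near admissible values. *)
Lemma barrier_ge0 (R : realType) (f : R -> R) (T : set R) :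
  countable T -> {within `[0, +oo[, continuous f} -> 0 <= f 0 ->
  (forall s, 0 <= s -> 0 <= f s -> \forall t \near s, s < t -> ~ T t ->
     derivable f t 1 /\ 0 <= 'D_1 f t) ->
  forall t, 0 <= t -> 0 <= f t.
Proof.
move=> cT cf f0 df b b0; rewrite leNgt; apply/negP => fb.
have cf' a c : 0 <= a -> {within `[a, c], continuous f}.
  move=> a0; apply: continuous_subspaceW cf => z /=.
  by rewrite !in_itv/= andbT => /andP[az _]; exact: le_trans az.
have [s [s0 sb fs slast]] := last_crossing _ _ _ _ _ b0 (cf' _ _ (lexx 0)) f0 fb.
have := df s s0; rewrite fs lexx => /(_ isT)[d /= d0 sd].
(* a time after s, before b and within the range of the local information *)
pose t := s + Num.min (d / 2) (b - s).
have m0 : 0 < Num.min (d / 2) (b - s) by rewrite lt_min divr_gt0//= subr_gt0.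
have st : s < t by rewrite ltrDl.
have tb : t <= b by rewrite /t -lerBrDl ge_min lexx orbT.
have td : t < s + d by rewrite ltrD2l gt_min; apply/orP; left; lra.
have : f s <= f t.
  apply: (derive_ge0_le _ _ T) => //; [exact: ltW|exact: cf'|].
  move=> r /andP[sr rt] Tr; apply: sd => //=.
  by rewrite distrC gtr0_norm ?subr_gt0// ltrBlDl; exact: lt_trans td.
by rewrite fs leNgt slast// st.
Qed.

Lemma within_continuous_coord (R : realType) (A : set R) (f : R -> 'cV[R]_2) i :
  {within A, continuous f} -> {within A, continuous (fun t => f t i 0)}.
Proof.
move=> /subspace_continuousP cf; apply/subspace_continuousP => t At.
exact: cvg_comp (cf t At) (@coord_continuous _ _ _ i 0 (f t)).
Qed.

Lemma is_derive_coord (R : realType) (f : R -> 'cV[R]_2) (t : R) w i :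
  is_derive t 1 f w -> is_derive t 1 (fun s => f s i 0) (w i 0).
Proof.
move=> fw; have df : derivable f t 1 by exact: ex_derive.
have := derive_mx df; rewrite derive_val => ->; rewrite mxE.
by apply: derivableP; apply: (derivable_mxP _ _ _).1 df i 0.
Qed.

Lemma within_continuousM (R : realType) (A : set R) (f g : R -> R) :
  {within A, continuous f} -> {within A, continuous g} ->
  {within A, continuous (fun t => f t * g t)}.
Proof. by move=> cf cg t; apply: cvgM; [exact: cf|exact: cg]. Qed.

(** * Corner vectors of a triangle *)

Lemma dot2E (R : realType) (u v : 'cV[R]_2) :
  dot u v = u 0 0 * v 0 0 + u 1 0 * v 1 0.
Proof.
by rewrite /dot big_ord_recl big_ord1; congr (_ + u _ _ * v _ _); apply/val_inj.
Qed.

Lemma quarter_turnE (R : realType) (u : 'cV[R]_2) :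
  (quarter_turn u 0 0 = - u 1 0) * (quarter_turn u 1 0 = u 0 0).
Proof. by rewrite !mxE. Qed.

Lemma quarter_turnB (R : realType) (u v : 'cV[R]_2) :
  quarter_turn (u - v) = quarter_turn u - quarter_turn v.
Proof. by apply/colP => i; rewrite !mxE; case: (i == 0) => //; rewrite opprD. Qed.

Lemma dot0r (R : realType) (u : 'cV[R]_2) : dot u 0 = 0.
Proof. by rewrite dot2E !mxE !mulr0 addr0. Qed.

Lemma dotDr (R : realType) (u v w : 'cV[R]_2) : dot u (v + w) = dot u v + dot u w.
Proof. by rewrite !dot2E !mxE; ring. Qed.

Lemma dotZr (R : realType) (k : R) (u v : 'cV[R]_2) : dot u (k *: v) = k * dot u v.
Proof. by rewrite !dot2E !mxE; ring. Qed.

Lemma dotDl (R : realType) (u v w : 'cV[R]_2) : dot (u + v) w = dot u w + dot v w.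
Proof. by rewrite !dot2E !mxE; ring. Qed.

Lemma dotZl (R : realType) (k : R) (u v : 'cV[R]_2) : dot (k *: u) v = k * dot u v.
Proof. by rewrite !dot2E !mxE; ring. Qed.

Lemma enorm_quarter_turn (R : realType) (u : 'cV[R]_2) :
  enorm (quarter_turn u) = enorm u.
Proof. by rewrite /enorm !dot2E !quarter_turnE; congr Num.sqrt; ring. Qed.

Lemma enorm_eq0 (R : realType) (u : 'cV[R]_2) : enorm u = 0 -> u = 0.
Proof.
move/eqP; rewrite sqrtr_eq0 dot2E => h.
have [u0 u1] : u 0 0 = 0 /\ u 1 0 = 0 by nra.
apply/colP => i; rewrite mxE.
case: (ltnP i 1) => [|i1].
  by rewrite ltnS leqn0 => /eqP i0; rewrite (_ : i = 0)//; apply/val_inj.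
rewrite (_ : i = 1)//; apply/val_inj/eqP; rewrite eqn_leq i1 andbT.
by rewrite -ltnS ltn_ord.
Qed.

(** Twice the signed area of the triangle [x p, x q, x r]. *)
Definition cross {R : realType} {K : mesh} (x : node K -> 'cV[R]_2) p q r : R :=
  dot (quarter_turn (x q - x p)) (x r - x p).

Lemma cross_rot (R : realType) (K : mesh) (x : node K -> 'cV[R]_2) p q r :
  cross x p q r = cross x q r p.
Proof. by rewrite /cross !dot2E !quarter_turnE !mxE; ring. Qed.

(** The length cancels against the normalisation, which leaves a formula
    polynomial in the positions up to the sign that selects the outward
    side. *)
Lemma weighted_edge_normal (R : realType) (K : mesh) (x : node K -> 'cV[R]_2)
    (c : cell K) p q :
  half_length x p q *: edge_normal x c p q =
    (Num.sg (dot (quarter_turn (x q - x p)) (x p - centroid x c)) / 2) *: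
      quarter_turn (x q - x p).
Proof.
rewrite /half_length /edge_normal /= enorm_quarter_turn.
have [/eqP/enorm_eq0 ->|n0] := boolP (enorm (x q - x p) == 0).
  by rewrite (_ : quarter_turn 0 = 0) ?scaler0//; apply/colP => i;
    rewrite !mxE oppr0 if_same.
by rewrite scalerA; congr (_ *: _); field.
Qed.

(** The two half edges at [p] are rotated, oriented by the triangle, and added:
    the corner vector is half the rotated opposite edge. The sign of both edge
    normals is governed by the signed area, since [x p] minus the centroid is
    a third of the sum of the two edge vectors pointing to [p]. *)
Lemma corner_opposite_edge (R : realType) (K : mesh) (x : node K -> 'cV[R]_2)
    (c : cell K) p q r :
  uniq [:: p; q; r] -> cell_nodes c = [set p; q; r]%SET ->
  corner x c p = (Num.sg (cross x p q r) / 2) *: quarter_turn (x r - x q).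
Proof.
rewrite /= !inE negb_or andbT => /andP[/andP[pq pr] qr] cE.
have sumE (F : node K -> 'cV[R]_2) :
    \sum_(s in cell_nodes c) F s = F p + F q + F r.
  rewrite cE -finset.setUA big_setU1 ?inE ?negb_or ?pq ?pr//=.
  by rewrite big_setU1 ?inE//= big_set1 addrA.
have cD : cell_nodes c :\ p = [set q; r]%SET.
  by rewrite cE -finset.setUA finset.setU1K// !inE negb_or pq pr.
rewrite /corner cD big_setU1 ?inE//= big_set1 !weighted_edge_normal.
have -> : dot (quarter_turn (x q - x p)) (x p - centroid x c) =
    - (3^-1 * cross x p q r).
  by rewrite /centroid sumE /cross !dot2E !quarter_turnE !mxE; field.
have -> : dot (quarter_turn (x r - x p)) (x p - centroid x c) =
    3^-1 * cross x p q r.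
  by rewrite /centroid sumE /cross !dot2E !quarter_turnE !mxE; field.
rewrite sgrN !sgrM (gtr0_sg (_ : 0 < 3^-1)) ?invr_gt0// mul1r.
by rewrite !quarter_turnB; apply/colP => i; rewrite !mxE; field.
Qed.

Lemma sum_cell_nodes (V : nmodType) (K : mesh) (c : cell K) (F : node K -> V) :
  \sum_(p in cell_nodes c) F p =
    F (vertex c 0) + F (vertex c 1) + F (vertex c 2).
Proof.
rewrite /cell_nodes big_imset/=; last by move=> i j _ _; exact: vertex_inj.
rewrite big_mkcond/= !big_ord_recl big_ord0 addr0 addrA.
by congr (F (vertex c _) + F (vertex c _) + F (vertex c _)); apply/val_inj.
Qed.

Lemma cell_nodesE (K : mesh) (c : cell K) :
  cell_nodes c = [set vertex c 0; vertex c 1; vertex c 2]%SET.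
Proof.
apply/setP => p; rewrite !inE; apply/imsetP/idP => [[i _ ->]|].
  by case: i => -[|[|[|//]]] ilt; rewrite !(inj_eq (@vertex_inj _ c)).
by move=> /orP[/orP[]|] /eqP ->; eexists.
Qed.

Lemma uniq_vertices (K : mesh) (c : cell K) :
  uniq [:: vertex c 0; vertex c 1; vertex c 2].
Proof. by rewrite /= !inE !(inj_eq (@vertex_inj _ c)). Qed.

Definition cell_cross {R : realType} {K : mesh} (x : node K -> 'cV[R]_2)
  (c : cell K) : R := cross x (vertex c 0) (vertex c 1) (vertex c 2).

Lemma volumeE (R : realType) (K : mesh) (x : node K -> 'cV[R]_2) (c : cell K) :
  volume x c = Num.sg (cell_cross x c) / 2 * cell_cross x c.
Proof. by rewrite /volume -/(cross x _ _ _) -/(cell_cross x c) normrEsg; ring. Qed.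

Lemma corner_vertices (R : realType) (K : mesh) (x : node K -> 'cV[R]_2)
    (c : cell K) (k := Num.sg (cell_cross x c) / 2) :
  [/\ corner x c (vertex c 0) =
        k *: quarter_turn (x (vertex c 2) - x (vertex c 1)),
      corner x c (vertex c 1) =
        k *: quarter_turn (x (vertex c 0) - x (vertex c 2)) &
      corner x c (vertex c 2) =
        k *: quarter_turn (x (vertex c 1) - x (vertex c 0))].
Proof.
have := uniq_vertices K c; rewrite /= !inE !negb_or !andbT => /andP[/andP[n01 n02] n12].
rewrite /k /cell_cross; split.
- apply: corner_opposite_edge; [exact: uniq_vertices | exact: cell_nodesE].
(* the signed area is invariant under cyclic relabelling of the vertices *)
- rewrite cross_rot; apply: corner_opposite_edge.
    by rewrite /= !inE !negb_or n12 !(eq_sym _ (vertex c 0)) n01 n02.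
  by rewrite cell_nodesE [RHS]finset.setUC [RHS]finset.setUA.
- rewrite 2!cross_rot; apply: corner_opposite_edge.
    by rewrite /= !inE !negb_or n01 !(eq_sym (vertex c 2)) n02 n12.
  by rewrite cell_nodesE -[RHS]finset.setUA [RHS]finset.setUC.
Qed.

(** The three opposite edges form a closed polygon. Hence a velocity common to
    the whole cell does not contribute to its change of volume. *)
Lemma sum_corner_eq0 (R : realType) (K : mesh) (x : node K -> 'cV[R]_2)
    (c : cell K) : \sum_(p in cell_nodes c) corner x c p = 0.
Proof.
have [e0 e1 e2] := corner_vertices R K x c.
rewrite sum_cell_nodes e0 e1 e2 -!scalerDr !quarter_turnB.
by rewrite [X in _ *: X](_ : _ = 0) ?scaler0//; apply/colP => i; rewrite !mxE; ring.
Qed.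

(** * Area of a moving triangle *)

(** The differential of [cell_cross] at [x] in the direction [y], sorted by
    vertex. *)
Definition cell_cross_diff {R : realType} {K : mesh} (x y : node K -> 'cV[R]_2)
    (c : cell K) : R :=
  dot (quarter_turn (x (vertex c 2) - x (vertex c 1))) (y (vertex c 0)) +
  dot (quarter_turn (x (vertex c 0) - x (vertex c 2))) (y (vertex c 1)) +
  dot (quarter_turn (x (vertex c 1) - x (vertex c 0))) (y (vertex c 2)).

Lemma cell_crossE (R : realType) (K : mesh) (x : node K -> R -> 'cV[R]_2) (c : cell K) :
  (fun t => cell_cross (x^~ t) c) =
  (fun t => x (vertex c 1) t 0 0 - x (vertex c 0) t 0 0) *
  (fun t => x (vertex c 2) t 1 0 - x (vertex c 0) t 1 0) -
  (fun t => x (vertex c 1) t 1 0 - x (vertex c 0) t 1 0) *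
  (fun t => x (vertex c 2) t 0 0 - x (vertex c 0) t 0 0) :> (R -> R).
Proof.
apply/funext => t.
rewrite /cell_cross /cross dot2E !quarter_turnE !mxE !fctE.
by ring.
Qed.

Lemma within_continuous_cross (R : realType) (K : mesh) (x : node K -> R -> 'cV[R]_2) (c : cell K)
    (A : set R) :
  (forall p, {within A, continuous (x p)}) ->
  {within A, continuous (fun t => cell_cross (x^~ t) c)}.
Proof.
move=> cx; rewrite cell_crossE.
by apply: within_continuousB; apply: within_continuousM;
  apply: within_continuousB; exact: within_continuous_coord.
Qed.

Lemma is_derive_cross (R : realType) (K : mesh) (x : node K -> R -> 'cV[R]_2) (c : cell K)
    (t : R) (w : node K -> 'cV[R]_2) :
  (forall p, is_derive t 1 (x p) (w p)) ->
  is_derive t 1 (fun t => cell_cross (x^~ t) c) (cell_cross_diff (x^~ t) w c).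
Proof.
move=> xw; rewrite cell_crossE.
have xwi p i : is_derive t 1 (fun s => x p s i 0) (w p i 0).
  exact: is_derive_coord.
apply: is_derive_eq.
rewrite /cell_cross_diff !dot2E !quarter_turnE !mxE /GRing.scale/=.
by ring.
Qed.

(** Up to the orientation sign, corner vectors are the gradient of the area of
    the cell with respect to the positions of its vertices. *)
Lemma sum_corner_dot (R : realType) (K : mesh) (x : node K -> R -> 'cV[R]_2) (c : cell K)
    (t : R) (w : node K -> 'cV[R]_2) :
  \sum_(p in cell_nodes c) dot (corner (x^~ t) c p) (w p) =
  Num.sg (cell_cross (x^~ t) c) / 2 * cell_cross_diff (x^~ t) w c.
Proof.
have [e0 e1 e2] := corner_vertices R K (x^~ t) c.
by rewrite sum_cell_nodes e0 e1 e2 !dotZl /cell_cross_diff !mulrDr.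
Qed.

(** A triangle that never degenerates keeps its orientation, so that the
    absolute value in [volume] can be differentiated. *)
Lemma sg_cross_constant (R : realType) (K : mesh) (x : node K -> R -> 'cV[R]_2) (c : cell K) :
  (forall p, {within `[0, +oo[, continuous (x p)}) ->
  (forall t, 0 <= t -> 0 < volume (x^~ t) c) ->
  forall t, 0 <= t ->
    Num.sg (cell_cross (x^~ t) c) = Num.sg (cell_cross (x^~ 0) c).
Proof.
move=> cx vol t t0.
have ne0 s : 0 <= s -> cell_cross (x^~ s) c != 0.
  by move=> /vol; rewrite volumeE; apply: contraTneq => ->; rewrite mulr0 ltxx.
apply/eqP/negPn/negP => sgne.
have [||s] := @IVT _ (fun t => cell_cross (x^~ t) c) 0 t 0 t0.
- apply: continuous_subspaceW (within_continuous_cross _ _ _ c _ cx) => z /=.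
  by rewrite !in_itv/= andbT => /andP[].
- move: (ne0 _ t0) (ne0 _ (lexx 0)) sgne.
  case: sgrP => [->|a|a] A0; case: sgrP => [->|b|b] B0;
    rewrite ?eqxx// in A0 B0 * => _;
    by rewrite ge_min le_max (ltW a) (ltW b) ?orbT.
by rewrite in_itv/= => /andP[s0 _] /eqP; rewrite (negPf (ne0 _ s0)).
Qed.

(** * Geometric conservation law *)

(** Corner vectors are the gradient of the volume,
    so when the discrete volume equation uses the same nodal velocities as the
    mesh motion, [m * tau] and the volume have equal derivatives outside [T];
    being continuous and equal initially, they coincide. *)
Lemma mass_eq_volume (R : realType) (K : mesh) (x : node K -> R -> 'cV[R]_2)
    (w : node K -> R -> 'cV[R]_2) (c : cell K) (tau : R -> R) (m : R) (T : set R) :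
  countable T ->
  (forall p, {within `[0, +oo[, continuous (x p)}) ->
  (forall t, 0 <= t -> 0 < volume (x^~ t) c) ->
  {within `[0, +oo[, continuous tau} ->
  m * tau 0 = volume (x^~ 0) c ->
  (forall p t, 0 < t -> ~ T t -> is_derive t 1 (x p) (w p t)) ->
  (forall t, 0 < t -> ~ T t -> derivable tau t 1 /\
     m * 'D_1 tau t = \sum_(p in cell_nodes c) dot (corner (x^~ t) c p) (w p t)) ->
  forall t, 0 <= t -> m * tau t = volume (x^~ t) c.
Proof.
move=> cT cx vol ctau m0 dx dtau t t0.
pose k := Num.sg (cell_cross (x^~ 0) c) / 2.
have volk s : 0 <= s -> volume (x^~ s) c = k * cell_cross (x^~ s) c.
  by move=> s0; rewrite volumeE (sg_cross_constant _ _ _ _ cx vol _ s0).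
pose f : R -> R := m \*: tau - k \*: (fun s => cell_cross (x^~ s) c).
have f0 : f 0 = 0.
  have -> : f 0 = m * tau 0 - k * cell_cross (x^~ 0) c by [].
  by rewrite m0 volk// subrr.
suff : f 0 = m * tau t - k * cell_cross (x^~ t) c.
  by rewrite f0 volk// => /esym/eqP; rewrite subr_eq0 => /eqP.
have sub : `[0, t] `<=` `[0, +oo[.
  by move=> z /=; rewrite !in_itv/= andbT => /andP[].
apply: (derive_eq0_eq _ _ T) => //.
  apply: within_continuousB => s.
    by apply: cvgZr; exact: (continuous_subspaceW sub ctau).
  apply: cvgZr; apply: (continuous_subspaceW sub).
  exact: within_continuous_cross.
move=> s /andP[s0 st] Ts.
have [dts tauE] := dtau s s0 Ts.
have dxs p := dx p s s0 Ts.
have dcr := is_derive_cross _ _ _ c _ _ dxs.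
have dtaus := derivableP dts.
apply: is_derive_eq.
rewrite /GRing.scale/= tauE sum_corner_dot.
by rewrite (sg_cross_constant _ _ _ _ cx vol _ (ltW s0)) subrr.
Qed.

(** * Equation of state *)

Lemma eos_convex (R : realType) (eps : R -> R -> R) (s s' e e' l : R) :
  equation_of_state eps -> 0 < s -> 0 <= e -> 0 < s' -> 0 <= e' ->
  0 <= l <= 1 ->
  eps (l * s + (1 - l) * s') (l * e + (1 - l) * e') <=
    l * eps s e + (1 - l) * eps s' e'.
Proof.
case=> _ cvx _ _ s0 e0 s'0 e'0 /andP[l0 l1].
have := cvx (Itv01 l0 l1) (s, e) (s', e').
by rewrite !inE; apply.
Qed.

Lemma eos_derivable_volume (R : realType) (eps : R -> R -> R) (s e : R) :
  equation_of_state eps -> 0 < s -> 0 <= e -> derivable (eps^~ e) s 1.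
Proof.
move=> [[U [_ UD Ceps]] _ _ _] s0 e0.
have Use : U (s, e) by apply: UD; split.
have [_ [dU _ _]] := Ceps 1%N.
exact: (dU _ Use).1.
Qed.

(** Nonnegative pressure at zero entropy integrates to monotonicity of the energy
    there. *)
Lemma cold_energy_nincr (R : realType) (eps : R -> R -> R) (s s' : R) :
  equation_of_state eps -> (forall r, 0 < r -> 0 <= pressure eps r 0) ->
  0 < s -> s <= s' -> eps s' 0 <= eps s 0.
Proof.
move=> heps hcold s0 ss'.
have dU r : 0 < r -> derivable (eps^~ 0) r 1.
  by move=> r0; exact: eos_derivable_volume.
apply: (@ler0_derive1_le_cc _ (eps^~ 0) s s') => //.
- by move=> r; rewrite in_itv/= => /andP[sr _]; apply: dU; exact: lt_trans sr.
- move=> r; rewrite in_itv/= => /andP[sr _].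
  by rewrite -oppr_ge0; apply: hcold; exact: lt_trans sr.
- apply: derivable_within_continuous => r; rewrite in_itv/= => /andP[sr _].
  by apply: dU; exact: lt_le_trans sr.
- by rewrite in_itv/= ss' lexx.
- by rewrite in_itv/= ss' lexx.
Qed.

(** If the pressure were negative at [(s, e)], convexity along the isentrope
    would make [eps] grow at least linearly as the specific volume [s + N * k]
    increases. But this point is the midpoint of [(s + 2 * N * k, 0)] and
    [(s, 2 * e)]: the energy of the former is at most [eps s 0] because the
    cold energy is nonincreasing, and that of the latter is fixed, so by joint
    convexity the energy stays bounded. *)
Lemma pressure_ge0 (R : realType) (eps : R -> R -> R) (s e : R) :
  equation_of_state eps -> (forall r, 0 < r -> 0 <= pressure eps r 0) ->
  0 < s -> 0 <= e -> 0 <= pressure eps s e.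
Proof.
move=> heps hcold s0 e0; rewrite leNgt oppr_lt0; apply/negP => dpos.
have ds : derivable (eps^~ e) s 1 by exact: eos_derivable_volume.
have [|h h0 /(_ (s + h / 2))hlt] := derive_gt0_right _ _ _ ds.
  by rewrite -derive1E.
pose k := h / 2; pose g := eps (s + k) e - eps s e.
have k0 : 0 < k by rewrite divr_gt0.
have g0 : 0 < g by rewrite subr_gt0 hlt// ltrDl k0/= ltrD2l /k; lra.
pose C := (eps s 0 + eps s (2 * e)) / 2 - eps s e.
(* Linear growth with slope g per step k overtakes the bound C after N steps *)
pose N := 1 + `|C| / g.
have N1 : 1 <= N by rewrite lerDl divr_ge0// ltW.
have N0 : 0 < N by exact: lt_le_trans N1.
have lo : eps s e + N * g <= eps (s + N * k) e.
  have := @eos_convex _ eps (s + N * k) s e e N^-1 heps.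
  rewrite invr_ge0 (ltW N0) invf_le1// N1 s0 e0 addr_gt0// ?mulr_gt0//.
  move=> /(_ isT isT isT isT isT).
  have -> : N^-1 * (s + N * k) + (1 - N^-1) * s = s + k by field; lra.
  have -> : N^-1 * e + (1 - N^-1) * e = e by ring.
  move=> /(ler_wpM2l (ltW N0)).
  rewrite [leRHS](_ : _ = eps (s + N * k) e + (N - 1) * eps s e); last first.
    by field; lra.
  by rewrite /g; lra.
have up : eps (s + N * k) e <= (eps s 0 + eps s (2 * e)) / 2.
  have := @eos_convex _ eps (s + 2 * (N * k)) s 0 (2 * e) 2^-1 heps.
  have Nk : 0 < N * k by rewrite mulr_gt0.
  move=> /(_ ltac:(lra) ltac:(lra) ltac:(lra) ltac:(lra) ltac:(lra)).
  have -> : 2^-1 * (s + 2 * (N * k)) + (1 - 2^-1) * s = s + N * k by field.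
  have -> : 2^-1 * 0 + (1 - 2^-1) * (2 * e) = e by field.
  have := @cold_energy_nincr _ eps s (s + 2 * (N * k)) heps hcold s0 ltac:(lra).
  lra.
have : N * g = g + `|C| by rewrite /N; field; lra.
have := ler_norm C.
by rewrite {1}/C; lra.
Qed.

(** The equation of state is smooth on a neighbourhood of the thermodynamic
    domain, so positivity of the temperature at an admissible state extends to
    nearby states, even those with slightly negative entropy. *)
Lemma temperature_gt0_near (R : realType) (eps : R -> R -> R) (f g : R -> R)
    (A : set R) (s : R) :
  equation_of_state eps -> {within A, continuous f} ->
  {within A, continuous g} -> A s -> 0 < f s -> 0 <= g s ->
  \forall t \near s, A t -> 0 < temperature eps (f t) (g t).
Proof.
move=> [[U [_ UD Ceps]] _ _ tpos] /subspace_continuousP cf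
  /subspace_continuousP cg As fs gs.
have Ufg : thermo_domain (f s, g s) by split.
have [_ [_ _ [cT _]]] := Ceps 1%N.
have /= := cT _ (UD _ Ufg).
rewrite /continuous_at/= => cT'.
have cTfg : temperature eps (f t) (g t) @[t --> within A (nbhs s)] -->
    temperature eps (f s) (g s).
  have cfg : (f t, g t) @[t --> within A (nbhs s)] --> (f s, g s).
    exact: cvg_pair (cf _ As) (cg _ As).
  exact: (@cvg_comp _ _ _ (fun t => (f t, g t)) (fun z => dS eps z.1 z.2)
    _ _ _ cfg cT').
exact: (cvgr_gt _ cTfg _ (tpos _ _ Ufg)).
Qed.

(** * Entropy production at a corner *)

(** A nonnegative combination of the rank one forms [w |-> dot n w ^+ 2]. The
    acoustic impedance, sound speed over [s], is a square root up to the sign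
    of [s], hence nonnegative even where the entropy is not known to be. *)
Lemma corner_matrix_form_ge0 (R : realType) (K : mesh) (eps : R -> R -> R)
    (x : node K -> 'cV[R]_2) (c : cell K) p (s e : R) (w : 'cV[R]_2) :
  0 <= s -> 0 <= dot w (corner_matrix eps x c p s e *m w).
Proof.
move=> s0; rewrite /corner_matrix -scalemxAl dotZr mulr_ge0//.
  by rewrite /sound_speed !mulr_ge0 ?invr_ge0 ?sqrtr_ge0.
rewrite mulmx_suml (big_morph _ (dotDr R w) (dot0r R w)) sumr_ge0// => q _.
move: (edge_normal x c p q) => n.
have -> : dot w ((half_length x p q *: (n *m n^T)) *m w) =
    half_length x p q * dot n w ^+ 2.
  rewrite -scalemxAl dotZr -mulmxA; congr (_ * _).
  have -> : n *m (n^T *m w) = dot n w *: n.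
    apply/colP => i; rewrite !mxE big_ord1 [X in _ * X]mxE mulrC; congr (_ * _).
    by rewrite /dot; apply: eq_bigr => j _; rewrite !mxE.
  by rewrite dotZr !dot2E; ring.
by rewrite mulr_ge0 ?sqr_ge0// divr_ge0 ?sqrtr_ge0.
Qed.

(** * Positivity of the scheme *)

Theorem theorem3p3 (R : realType) (K : mesh) (eps : R -> R -> R)
  (x : node K -> R -> 'cV[R]_2)
  (tau : cell K -> R -> R) (v : cell K -> R -> 'cV[R]_2) (S : cell K -> R -> R)
  (vC vS : node K -> R -> 'cV[R]_2) (pC alphaC : node K -> R -> R)
  (beta : node K -> R -> bool)
  (m : cell K -> R)
  (* at most countably many exceptional (switching) times *)
  (T : set R)
  (* equation of state; hcold: no tension on the isentrope S = 0 *)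
  (heps : equation_of_state eps)
  (hcold : forall s, 0 < s -> 0 <= pressure eps s 0)
  (* mesh *)
  (hconf : forall t, 0 <= t -> conforming (x^~ t))
  (hvol : forall c t, 0 <= t -> 0 < volume (x^~ t) c)
  (hm : forall c, m c = volume (x^~ 0) c / tau c 0)
  (* well prepared initial data *)
  (htau0 : forall c, 0 < tau c 0)
  (hS0 : forall c, 0 <= S c 0)
  (* nodal quantities; unconstrained (boundary conditions) at boundary nodes *)
  (hvC : forall p t, 0 <= t -> ~~ boundary_node p ->
     vC p t = nodal_velocity (x^~ t) (v^~ t) p)
  (hpC : forall p t, 0 <= t -> ~~ boundary_node p ->
     pC p t =
       nodal_pressure (x^~ t) (fun c => pressure eps (tau c t) (S c t)) p)
  (halphaC : forall p t, 0 <= t -> ~~ boundary_node p ->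
     alphaC p t =
       nodal_alpha (x^~ t) (v^~ t) (fun c => pressure eps (tau c t) (S c t))
         (vC p t) (pC p t) p)
  (hvS : forall p t, 0 <= t -> ~~ boundary_node p ->
     (\sum_(c in node_cells p)
        corner_matrix eps (x^~ t) c p (tau c t) (S c t)) *m vS p t =
     \sum_(c in node_cells p)
       (pressure eps (tau c t) (S c t) *: corner (x^~ t) c p
        + corner_matrix eps (x^~ t) c p (tau c t) (S c t) *m v c t))
  (* continuous unknowns, satisfying the equations outside T *)
  (hT : countable T)
  (hxc : forall p, {within `[0, +oo[, continuous (x p)})
  (htauc : forall c, {within `[0, +oo[, continuous (tau c)})
  (hvc : forall c, {within `[0, +oo[, continuous (v c)})
  (hSc : forall c, {within `[0, +oo[, continuous (S c)})
  (hnode : forall p t, 0 < t -> ~ T t ->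
     is_derive t 1 (x p)
       ((1 - (beta p t)%:R) *: vC p t + (beta p t)%:R *: vS p t))
  (hdiff : forall c t, 0 < t -> ~ T t ->
     [/\ derivable (tau c) t 1, derivable (v c) t 1 & derivable (S c) t 1])
  (hscheme : forall c t, 0 < t -> ~ T t ->
     (m c *: 'D_1 (tau c) t, m c *: 'D_1 (v c) t, m c *: 'D_1 (S c) t) =
     \sum_(p in cell_nodes c)
       ((1 - (beta p t)%:R) *:
          flux_conservative (x^~ t) c p (vC p t) (pC p t) (alphaC p t)
            (v c t) (pressure eps (tau c t) (S c t))
        + (beta p t)%:R *:
          flux_stable eps (x^~ t) c p (vS p t) (tau c t) (v c t) (S c t))) :
  forall c t, 0 <= t ->
    [/\ 0 < (tau c t)^-1,
        0 <= pressure eps (tau c t) (S c t) &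
        0 <= temperature eps (tau c t) (S c t)].
Proof.
have pair1 (r : seq (node K)) P (F : node K -> R * 'cV[R]_2 * R) :
    (\sum_(p <- r | P p) F p).1.1 = \sum_(p <- r | P p) (F p).1.1.
  exact: (big_morph (fun z : R * 'cV[R]_2 * R => z.1.1) (fun _ _ => erefl) erefl).
have pair3 (r : seq (node K)) P (F : node K -> R * 'cV[R]_2 * R) :
    (\sum_(p <- r | P p) F p).2 = \sum_(p <- r | P p) (F p).2.
  exact: (big_morph (fun z : R * 'cV[R]_2 * R => z.2) (fun _ _ => erefl) erefl).
have m0 c : 0 < m c by rewrite hm divr_gt0 ?hvol.
have mass c : forall t, 0 <= t -> m c * tau c t = volume (x^~ t) c.
  apply: (mass_eq_volume _ _ _ _ _ _ _ _ hT hxc _ (htauc c) _ hnode).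
  - by move=> t; exact: hvol.
  - by rewrite hm divfK// gt_eqF.
  - move=> t t0 Tt; have [dtau _ _] := hdiff c t t0 Tt; split => //.
    have /(congr1 (fun z => z.1.1)) := hscheme c t t0 Tt.
    rewrite pair1/= => e; apply: (etrans e).
    (* both fluctuations contain the flux of the same blended velocity that
       moves the nodes *)
    transitivity (\sum_(p in cell_nodes c)
      (dot (corner (x^~ t) c p)
        ((1 - (beta p t)%:R) *: vC p t + (beta p t)%:R *: vS p t)
       - dot (corner (x^~ t) c p) (v c t))).
      apply: eq_bigr => p _; rewrite /GRing.scale/= !dot2E !mxE.
      by ring.
    rewrite sumrB -[X in _ - X](big_morph (fun u => dot u (v c t))
      (fun a b => dotDl R a b (v c t)) (_ : dot 0 _ = 0)); last first.
      by rewrite dot2E !mxE !mul0r addr0.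
    by rewrite sum_corner_eq0 dot2E !mxE !mul0r addr0 subr0.
have tau0 c t : 0 <= t -> 0 < tau c t.
  by move=> t0; rewrite -(pmulr_rgt0 _ (m0 c)) mass// hvol.
have S0 c : forall t, 0 <= t -> 0 <= S c t.
  apply: (barrier_ge0 _ _ T) => // s s0 Ss.
  have As : `[0, +oo[%classic s by rewrite /= in_itv/= s0.
  have := temperature_gt0_near _ _ _ _ _ _ heps (htauc c) (hSc c) As (tau0 c s s0) Ss.
  apply: filterS => t thpos st Tt.
  have t0 : 0 < t by exact: le_lt_trans st.
  have th : 0 < temperature eps (tau c t) (S c t).
    by apply: thpos; rewrite /= in_itv/= ltW.
  have [_ _ dS] := hdiff c t t0 Tt; split => //.
  rewrite -(pmulr_rge0 _ (m0 c)).
  have /(congr1 (fun z => z.2)) := hscheme c t t0 Tt.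
  rewrite pair3/= => e; rewrite [leRHS]e.
  apply: sumr_ge0 => p _.
  rewrite scaler0 add0r /GRing.scale/= !mulr_ge0 ?invr_ge0 ?(ltW th)//.
  by apply: corner_matrix_form_ge0; exact/ltW/tau0/ltW.
move=> c t t0; split.
- by rewrite invr_gt0 tau0.
- by apply: pressure_ge0 => //; [exact: tau0|exact: S0].
- have [_ _ _ th] := heps; apply/ltW/th; split; [exact: tau0|exact: S0].
Qed.
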